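(* Let $R>0$. (1) Let $\lambda_1\in(0,\frac14]$ and $\gamma=1$. Then there exists a collection $\mathcal{P}$ (in some dimension $n$, with Gaussian prior $\pi$ as described in the context, so that $\mathbb{E}_\pi[\|x^\star\|_2^2]=R^2$) of perfectly conditioned interpolating problems with squared error $F(x;(A,b))=\frac12\|Ax-b\|_2^2$, each satisfying the $\gamma$-growth condition with $\gamma=1$, the given $\lambda_1$, and some $\lambda_0>0$, i.e. for all $\alpha\ge0$ and $x\in\mathbb{R}^n$, $$\mathbb{E}\Big[(F(x;S)-F(x^\star;S))\min\Big\{\alpha,\frac{F(x;S)-F(x^\star;S)}{\|\nabla F(x;S)\|_2^2}\Big\}\Big]\ge\min\{\lambda_0\alpha,\lambda_1\}\|x-x^\star\|_2^2,$$ such that for every $k\ge1$ $$\mathfrak{M}_k(\mathcal{P},\pi)\ge R^2(1-4\lambda_1)^k.$$ (2) Let $\rho\in[1,\infty)$. Then there exists a collection $\mathcal{P}$ (in some dimension $n$, with Gaussian prior $\pi$ as described in the context) of perfectly conditioned interpolating problems with squared error $F(x;(A,b))=\frac12\|Ax-b\|_2^2$, each with noise-to-signal ratio satisfying $\sup_{x\neq x^\star}\frac{\operatorname{Var}(\nabla F(x;S))}{\|\nabla f(x)\|_2^2}\le\rho$, such that for every $k\ge1$ $$\mathfrak{M}_k(\mathcal{P},\pi)\ge R^2\Big(1-\frac1\rho\Big)^k.$$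
   Context: Collections: for $n,m\in\mathbb{N}$, a collection $\mathcal{P}$ of noiseless linear regression problems on $\mathbb{R}^n$ (domain $\mathcal{X}=\mathbb{R}^n$) consists of problems indexed by $x^\star\in\mathbb{R}^n$: a sample is $S=(A,b)$ with $A\in\mathbb{R}^{m\times n}$ random (with a law that is the same for all problems in the collection) and $b=Ax^\star$; the loss is $F(x;(A,b))=\frac12\|Ax-b\|_2^2$ and $f(x)=\mathbb{E}[F(x;S)]$. The problem is an interpolation problem: $F(x^\star;S)=0=\inf_xF(x;S)$ almost surely. It is called perfectly conditioned if $f(x)=c\|x-x^\star\|_2^2$ for all $x$, for a constant $c>0$ (so $x^\star$ is the unique minimizer of $f$). The prior $\pi$ on the collection is identified with $x^\star\sim\mathsf{N}(0,\frac{R^2}{n}I_n)$. Minimum average risk: $$\mathfrak{M}_k(\mathcal{P},\pi)=\inf_{\widehat{x}^k}\int\mathbb{E}_{P^k}\big[\operatorname{dist}(\widehat{x}^k,\mathcal{X}^\star(F,P))^2\big]\,d\pi(F,P),$$ where $\mathcal{X}^\star(F,P)=\operatorname{argmin}_x\mathbb{E}_P[F(x;S)]$ (here $\{x^\star\}$) and the infimum is over all measurable functions $\widehat{x}^k$ of the i.i.d. samples $S_1,\ldots,S_k\sim P$ (conditionally on the problem). $\operatorname{Var}(Z)=\mathbb{E}[\|Z-\mathbb{E}Z\|_2^2]$ for random vectors. In the growth condition the integrand is $0$ when $F(x;S)=F(x^\star;S)$. *)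

(* Defs.v *)
From HB Require Import structures.
From mathcomp Require Import all_boot all_order all_algebra.
From mathcomp Require Import all_classical all_reals all_analysis.
From mathcomp Require Import measurable_realfun.

Set Implicit Arguments.
Unset Strict Implicit.
Unset Printing Implicit Defensive.

Import Order.TTheory GRing.Theory Num.Theory.
Import numFieldNormedType.Exports.

Local Open Scope classical_set_scope.
Local Open Scope ring_scope.

(* 'M[T]_(m, n) carries the sigma-algebra generated by the entries; for
   T = R this is the Borel sigma-algebra. *)
Definition measure_mx_display : measure_display -> measure_display.
Proof. exact. Qed.

Section measurable_matrix.
Context {d} {T : measurableType d} (m n : nat).

Definition mx_sigma : set (set 'M[T]_(m, n)) :=
  <<s \bigcup_(ij in [set: 'I_m * 'I_n])
        preimage_set_system [set: 'M[T]_(m, n)]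
          (fun A : 'M[T]_(m, n) => A ij.1 ij.2) measurable >>.

Let mx_sigma0 : mx_sigma set0.
Proof. exact: sigma_algebra0. Qed.

Let mx_sigmaC (A : set 'M[T]_(m, n)) : mx_sigma A -> mx_sigma (~` A).
Proof. exact: sigma_algebraC. Qed.

Let mx_sigmaU (F : (set 'M[T]_(m, n))^nat) :
  (forall i, mx_sigma (F i)) -> mx_sigma (\bigcup_i F i).
Proof. exact: sigma_algebra_bigcup. Qed.

HB.instance Definition _ := @isMeasurable.Build (measure_mx_display d)
  'M[T]_(m, n) mx_sigma mx_sigma0 mx_sigmaC mx_sigmaU.

Lemma measurable_mx_entry (i : 'I_m) (j : 'I_n) :
  measurable_fun [set: 'M[T]_(m, n)] (fun A : 'M[T]_(m, n) => A i j).
Proof.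
move=> _ Y mY; apply: sub_sigma_algebra; exists (i, j) => //=.
by exists Y.
Qed.

Lemma measurable_fun_mxP d' (X : measurableType d') (f : X -> 'M[T]_(m, n)) :
  (forall i j, measurable_fun [set: X] (fun x => f x i j)) ->
  measurable_fun [set: X] f.
Proof.
move=> mf; apply: (@measurability _ _ _ _ _ _
  (\bigcup_(ij in [set: 'I_m * 'I_n])
        preimage_set_system [set: 'M[T]_(m, n)]
          (fun A : 'M[T]_(m, n) => A ij.1 ij.2) measurable)) => //.
move=> _ [_ [[i j] _ [B mB <-]] <-]; rewrite setTI.
exact: mf.
Qed.

End measurable_matrix.

Section iid.
Context {d} {T : measurableType d} {R : realType}.

Definition cons_pair (k : nat) (xt : T * k.-tuple T) : k.+1.-tuple T :=
  [tuple of xt.1 :: xt.2].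

Lemma measurable_cons_pair k :
  measurable_fun [set: T * k.-tuple T] (@cons_pair k).
Proof. exact: measurable_cons. Qed.

HB.instance Definition _ k := isMeasurableFun.Build _ _
  (T * k.-tuple T)%type (k.+1.-tuple T) (@cons_pair k)
  (@measurable_cons_pair k).

(* P^k *)
Fixpoint iid_law (P : probability T R) (k : nat) :
    probability (k.-tuple T) R :=
  match k with
  | 0 => \d_([tuple] : 0.-tuple T)
  | j.+1 => distribution (P \x iid_law P j)%E (@cons_pair j)
  end.

End iid.

Section gaussian.
Context {R : realType}.

(* The laws of the library on the real line, such as normal_prob, live on the
   copy measurableTypeR R of R. *)
Definition col_of_tuple (n : nat) (t : n.-tuple (measurableTypeR R)) :
    'cV[R]_n := \col_i tnth t i.

Lemma measurable_col_of_tuple n :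
  measurable_fun [set: n.-tuple (measurableTypeR R)] (@col_of_tuple n).
Proof.
apply: measurable_fun_mxP => i j.
rewrite (_ : (fun _ => _) = (fun t => tnth t i)); first exact: measurable_tnth.
by apply/funext => t; rewrite mxE.
Qed.

HB.instance Definition _ n := isMeasurableFun.Build _ _
  (n.-tuple (measurableTypeR R)) 'cV[R]_n (@col_of_tuple n)
  (@measurable_col_of_tuple n).

(* N(0, sigma^2 I_n): the coordinates are independent N(0, sigma^2). The
   second parameter of normal_prob is the standard deviation. *)
Definition iso_gaussian (n : nat) (sigma : R) : probability 'cV[R]_n R :=
  distribution (iid_law (normal_prob 0 sigma) n) (@col_of_tuple n).

End gaussian.

(* The norm that the library puts on 'cV[R]_n is the sup norm. *)
Definition l2norm {R : realType} {n : nat} (x : 'cV[R]_n) : R :=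
  Num.sqrt (\sum_i x i 0 ^+ 2).

Definition gradient {R : realType} {n : nat} (g : 'cV[R]_n -> R)
    (x : 'cV[R]_n) : 'cV[R]_n :=
  \col_i 'D_(delta_mx i 0) g x.

Section stochastic_problem.
Context {R : realType} {n : nat} {d} {S : measurableType d}.
Implicit Types (F : 'cV[R]_n -> S -> R) (P : probability S R).
Local Open Scope ereal_scope.

Definition risk F P (x : 'cV[R]_n) : \bar R := 'E_P[F x].

Definition minimizers F P : set 'cV[R]_n :=
  [set x | forall y, risk F P x <= risk F P y].

Definition dist_set (x : 'cV[R]_n) (A : set 'cV[R]_n) : \bar R :=
  ereal_inf [set (l2norm (x - y)%R)%:E | y in A].

Definition interpolating F P (xs : 'cV[R]_n) : Prop :=
  {ae P, forall s, F xs s = 0%R /\ inf (range (F ^~ s)) = 0%R}.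

Definition perfectly_conditioned F P (xs : 'cV[R]_n) : Prop :=
  exists2 c : R, (0 < c)%R &
    forall x, risk F P x = (c * l2norm (x - xs)%R ^+ 2)%:E.

(* With the conventions 0^-1 = +oo and 0 * +oo = 0 of \bar R, the integrand
   is 0 whenever F x s = F xs s. *)
Definition growth_integrand F (xs : 'cV[R]_n) (alpha : R) (x : 'cV[R]_n)
    (s : S) : \bar R :=
  let gap := (F x s - F xs s)%R in
  gap%:E * mine alpha%:E (gap%:E / (l2norm (gradient (F ^~ s) x) ^+ 2)%:E).

(* The growth condition with exponent gamma = 1. *)
Definition growth_condition1 F P (xs : 'cV[R]_n) (lambda0 lambda1 : R) : Prop :=
  forall (alpha : R) (x : 'cV[R]_n), (0 <= alpha)%R ->
    (Num.min (lambda0 * alpha)%R lambda1 * l2norm (x - xs)%R ^+ 2)%:E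
      <= \int[P]_s growth_integrand F xs alpha x s.

Definition vec_mean P (Z : S -> 'cV[R]_n) : 'cV[R]_n :=
  \col_i fine 'E_P[fun s => Z s i 0%R].

Definition vec_variance P (Z : S -> 'cV[R]_n) : \bar R :=
  \int[P]_s (l2norm (Z s - vec_mean P Z)%R ^+ 2)%:E.

Definition noise_to_signal F P (xs : 'cV[R]_n) : \bar R :=
  ereal_sup [set vec_variance P (fun s => gradient (F ^~ s) x)
                 / (l2norm (gradient (fine \o risk F P) x) ^+ 2)%:E
            | x in [set x | x != xs]].

End stochastic_problem.

Section minimum_average_risk.
Context {R : realType} {n : nat} {d} {S : measurableType d}.
Context {d'} {Theta : measurableType d'}.
Variables (F : 'cV[R]_n -> S -> R) (P : Theta -> probability S R).
Variable prior : probability Theta R.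
Local Open Scope ereal_scope.

Definition average_risk (k : nat) (xhat : k.-tuple S -> 'cV[R]_n) : \bar R :=
  \int[prior]_t \int[iid_law (P t) k]_s
    (dist_set (xhat s) (minimizers F (P t))) ^+ 2.

Definition min_average_risk (k : nat) : \bar R :=
  ereal_inf [set average_risk xhat |
    xhat in [set xhat : k.-tuple S -> 'cV[R]_n | measurable_fun setT xhat]].

End minimum_average_risk.

Section linear_regression.
Context {R : realType} {m n : nat}.

Definition squared_error (x : 'cV[R]_n) (s : 'M[R]_(m, n) * 'cV[R]_m) : R :=
  2^-1 * l2norm (s.1 *m x - s.2) ^+ 2.

Definition noiseless_sample (xs : 'cV[R]_n) (A : 'M[R]_(m, n)) :
    'M[R]_(m, n) * 'cV[R]_m := (A, A *m xs).

Lemma measurable_noiseless_sample xs :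
  measurable_fun [set: 'M[R]_(m, n)] (noiseless_sample xs).
Proof.
apply: measurable_fun_pair => //=.
apply: measurable_fun_mxP => i j.
rewrite (_ : (fun _ => _) =
  (fun A : 'M[R]_(m, n) => \sum_k A i k * xs k j)); last first.
  by apply/funext => A; rewrite mxE.
apply: measurable_sum => k; apply: measurable_funM => //.
exact: measurable_mx_entry.
Qed.

HB.instance Definition _ xs := isMeasurableFun.Build _ _
  'M[R]_(m, n) ('M[R]_(m, n) * 'cV[R]_m)%type (noiseless_sample xs)
  (measurable_noiseless_sample xs).

(* law of the sample (A, A xs) when A has law mu *)
Definition regression_law (mu : probability 'M[R]_(m, n) R) (xs : 'cV[R]_n) :
    probability ('M[R]_(m, n) * 'cV[R]_m)%type R :=
  distribution mu (noiseless_sample xs).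

End linear_regression.

(* N(0, (r^2 / n) I_n) *)
Definition regression_prior {R : realType} (n : nat) (r : R) :
    probability 'cV[R]_n R :=
  iso_gaussian n (Num.sqrt (r ^+ 2 / n%:R)).

(* Main.v *)
Require Import Defs.
From HB Require Import structures.
From mathcomp Require Import all_boot all_order all_algebra.
From mathcomp Require Import all_classical all_reals all_analysis.
From mathcomp Require Import measurable_realfun ring lra.
Import Order.TTheory GRing.Theory Num.Theory.
Import numFieldNormedType.Exports.
Local Open Scope classical_set_scope.
Local Open Scope ring_scope.

(* One dimension suffices. Let the design be A = 1 with probability p and A = 0
   otherwise. A sample with A = 0 is (0, 0) whatever xs is, so with probability
   (1 - p) ^+ k the k samples carry no information and the best estimator is the
   prior mean, with error r ^+ 2. On A = 1 the ratio of the gap to the squared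
   gradient is 1/2, so the growth condition holds with lambda1 = p / 4, and the
   noise-to-signal ratio is p^-1 - 1; take p = 4 * lambda1 and p = rho^-1. *)

(** * Second moment of the one-dimensional Gaussian *)

(** The density satisfies [phi' x = - (x / s ^+ 2) * phi x], so the product rule turns [y * phi y]
    into the difference between the variance integrand and [s ^+ 2 * phi]. *)
Lemma is_derive_id_mul_normal_pdf {R : realType} (s x : R) : s != 0 ->
  is_derive x 1 (fun y => - s ^+ 2 * (y * normal_pdf 0 s y))
    ((x ^+ 2 - s ^+ 2) * normal_pdf 0 s x).
Proof.
move=> s0; rewrite normal_pdfE// /normal_fun.
have hN : is_derive x 1 (fun y : R => - (y - 0) ^+ 2 / (s ^+ 2 *+ 2))
    (- (x / s ^+ 2)).
  apply: is_derive_eq.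
  rewrite !scaler0 ?add0r ?addr0 ?subr0 /GRing.scale/=; field.
  exact: s0.
have hE := is_derive1_comp (is_derive_expR _) hN.
apply: is_derive_eq.
rewrite /GRing.scale /=.
by field.
Qed.

(** From [u <= 1 + u <= expR u] at [u = x ^+ 2 / (s ^+ 2 *+ 2)], the product is at most a constant
    times [x^-1]; the squeeze does the rest. *)
Lemma cvg_id_mul_normal_pdf {R : realType} (s : R) : s != 0 ->
  x * normal_pdf 0 s x @[x --> +oo] --> (0 : R).
Proof.
move=> s0; have s2 : 0 < s ^+ 2 by rewrite exprn_even_gt0.
rewrite normal_pdfE//.
apply: (@squeeze_cvgr _ _ _ _ (cst 0)
  (fun x => (normal_peak s * (s ^+ 2 *+ 2)) * x^-1)).
- near=> x; have x0 : 0 < x by near: x; exact: nbhs_pinfty_gt.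
  apply/andP; split.
    by rewrite !mulr_ge0 ?normal_peak_ge0 ?expR_ge0// ltW.
  rewrite mulrCA -mulrA ler_wpM2l ?normal_peak_ge0//.
  rewrite /normal_fun subr0 mulNr expRN.
  rewrite -ler_pdivlMl// -[leRHS]invrK lef_pV2 ?posrE ?expR_gt0//; last first.
    by rewrite invr_gt0 !mulr_gt0 ?invr_gt0// mulrn_wgt0.
  apply: le_trans (expR_ge1Dx _).
  rewrite [X in X <= _](_ : _ = x ^+ 2 / (s ^+ 2 *+ 2)) ?lerDr ?ler01//.
  field; rewrite s0 gt_eqF//.
- exact: cvg_cst.
- rewrite -[X in _ --> X](mulr0 (normal_peak s * (s ^+ 2 *+ 2))).
  apply: cvgM; first exact: cvg_cst.
  apply/gtr0_cvgV0; last exact: cvg_id.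
  exact: nbhs_pinfty_gt.
Unshelve. all: by end_near. Qed.

Lemma continuous_sqr_mul_normal_pdf {R : realType} (c s : R) : s != 0 ->
  continuous (fun x => (c - x) ^+ 2 * normal_pdf 0 s x).
Proof.
move=> s0 x; apply: cvgM; last exact: continuous_normal_pdf.
apply: (cvg_comp (fun y => c - y) (fun y => y ^+ 2)); last first.
  exact: exprn_continuous.
by apply: cvgB; [exact: cvg_cst|exact: cvg_id].
Qed.

(* [(x ^+ 2 - s ^+ 2) * normal_pdf 0 s x] has the antiderivative
   [- s ^+ 2 * (x * normal_pdf 0 s x)], which vanishes at [0] and [+oo]; since
   it changes sign at [s], the half-line is cut there. *)
Lemma integral0y_sqr_normal_pdf {R : realType} (s : R) : 0 < s ->
  (\int[lebesgue_measure]_(x in `[0%R, +oo[) (x ^+ 2 * normal_pdf 0 s x)%:E =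
   \int[lebesgue_measure]_(x in `[0%R, +oo[) (s ^+ 2 * normal_pdf 0 s x)%:E)%E.
Proof.
move=> s_gt0; have s0 : s != 0 by rewrite gt_eqF.
pose phi := normal_pdf 0 s; rewrite -/phi.
pose F (y : R) : R := - s ^+ 2 * (y * phi y).
have dF x : is_derive x (1 : R) F ((x ^+ 2 - s ^+ 2) * phi x).
  exact: is_derive_id_mul_normal_pdf.
have cF : continuous F.
  move=> x; apply: differentiable_continuous; apply/derivable1_diffP.
  by have [] := dF x.
have dF1 x : derive1 F x = (x ^+ 2 - s ^+ 2) * phi x.
  by rewrite derive1E; have [_] := dF x.
have mphi : measurable_fun setT phi by exact: measurable_normal_pdf.
have cphi : continuous phi by exact: continuous_normal_pdf.
have phi0 x : 0 <= phi x by exact: normal_pdf_ge0.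
have m1 : measurable_fun setT (fun x : R => x ^+ 2 * phi x).
  by apply: measurable_funM => //; exact: measurable_funX.
have m2 : measurable_fun setT (fun x : R => s ^+ 2 * phi x).
  exact: measurable_funM.
have c3 : continuous (fun x : R => (x ^+ 2 - s ^+ 2) * phi x).
  move=> x; apply: cvgM; last exact: cphi.
  by apply: cvgB; [exact: exprn_continuous|exact: cvg_cst].
have m3 : measurable_fun setT (fun x : R => (x ^+ 2 - s ^+ 2) * phi x).
  exact: continuous_measurable_fun.
have m3' : measurable_fun setT (fun x : R => (s ^+ 2 - x ^+ 2) * phi x).
  rewrite (_ : (fun _ => _) = \- (fun x : R => (x ^+ 2 - s ^+ 2) * phi x)).
    exact: measurableT_comp.
  by apply/funext => x /=; rewrite -[RHS]mulNr opprB.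
have F0 : F 0 = 0 by rewrite /F mul0r mulr0.
have split01 : `[0%R, +oo[%classic = `[0%R, s[ `|` `[s, +oo[ :> set R.
  apply/seteqP; split => x/=; rewrite !in_itv/= !andbT.
    by move=> x0; case: (ltP x s) => xs; [left; rewrite x0|right].
  by case=> [/andP[]//|]; exact: le_trans (ltW s_gt0).
have disj : [disjoint `[0%R, s[%classic & `[s, +oo[%classic : set R].
  apply/disj_set2P/seteqP; split => // x/=.
  by rewrite !in_itv/= andbT => -[/andP[_ xs]]; rewrite leNgt xs.
rewrite split01 !ge0_integral_setU//=; last 4 first.
- by apply/measurable_EFinP; exact: measurable_funTS m2.
- by move=> x _; rewrite lee_fin mulr_ge0// sqr_ge0.
- by apply/measurable_EFinP; exact: measurable_funTS m1.
- by move=> x _; rewrite lee_fin mulr_ge0// sqr_ge0.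
(* The boundary term [- F s] is nonnegative and the same in [below] and [above], but the two
   integrands swap sides. Adding the pieces therefore gives equality using only sums of nonnegative
   terms in [\bar R], with no finiteness to check. *)
have below : (\int[lebesgue_measure]_(x in `[0%R, s[) (s ^+ 2 * phi x)%:E =
    (- F s)%:E +
    \int[lebesgue_measure]_(x in `[0%R, s[) (x ^+ 2 * phi x)%:E)%E.
  rewrite (_ : (- F s)%:E =
      \int[lebesgue_measure]_(x in `[0%R, s[) ((s ^+ 2 - x ^+ 2) * phi x)%:E)%E.
    rewrite -ge0_integralD//=.
    - by apply: eq_integral => x _; rewrite -EFinD -mulrDl subrK.
    - move=> x; rewrite in_itv/= => /andP[x0 xs].
      rewrite lee_fin mulr_ge0// subr_ge0.
      by rewrite lerXn2r ?nnegrE ?(ltW s_gt0) ?(ltW xs).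
    - by apply/measurable_EFinP; exact: measurable_funTS m3'.
    - by move=> x _; rewrite lee_fin mulr_ge0// sqr_ge0.
    - by apply/measurable_EFinP; exact: measurable_funTS m1.
  rewrite integral_itv_bndo_bndc; last first.
    by apply/measurable_EFinP; exact: measurable_funTS m3'.
  rewrite (@continuous_FTC2 _ _ (fun x => - F x))//=.
  - by rewrite F0 oppr0 sube0.
  - apply: continuous_subspaceT => x.
    rewrite (_ : (fun _ => _) = \- (fun x : R => (x ^+ 2 - s ^+ 2) * phi x)).
      by apply: cvgN; exact: c3.
    by apply/funext => y /=; rewrite -[RHS]mulNr opprB.
  - split.
    + by move=> x _; apply: derivableN; have [] := dF x.
    + by apply: cvg_at_right_filter; apply: cvgN; exact: cF.
    + by apply: cvg_at_left_filter; apply: cvgN; exact: cF.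
  - move=> x _; rewrite derive1E deriveN; last by have [] := dF x.
    by rewrite -derive1E dF1 -[LHS]mulNr opprB.
have above : (\int[lebesgue_measure]_(x in `[s, +oo[) (x ^+ 2 * phi x)%:E =
    (- F s)%:E +
    \int[lebesgue_measure]_(x in `[s, +oo[) (s ^+ 2 * phi x)%:E)%E.
  rewrite (_ : (- F s)%:E =
      \int[lebesgue_measure]_(x in `[s, +oo[) ((x ^+ 2 - s ^+ 2) * phi x)%:E)%E.
    rewrite -ge0_integralD//=.
    - by apply: eq_integral => x _; rewrite -EFinD -mulrDl subrK.
    - move=> x; rewrite in_itv/= andbT => sx.
      have x0 := le_trans (ltW s_gt0) sx.
      by rewrite lee_fin mulr_ge0// subr_ge0 lerXn2r ?nnegrE ?(ltW s_gt0).
    - by apply/measurable_EFinP; exact: measurable_funTS m3.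
    - by move=> x _; rewrite lee_fin mulr_ge0// sqr_ge0.
    - by apply/measurable_EFinP; exact: measurable_funTS m2.
  rewrite (@ge0_continuous_FTC2y _ _ F _ 0)//=.
  - by rewrite add0e.
  - move=> x sx; have x0 := le_trans (ltW s_gt0) sx.
    by rewrite mulr_ge0// subr_ge0 lerXn2r ?nnegrE ?(ltW s_gt0).
  - exact: continuous_subspaceT.
  - rewrite -[X in _ --> X](mulr0 (- s ^+ 2)).
    apply: cvgM; first exact: cvg_cst.
    exact: cvg_id_mul_normal_pdf.
  - by apply: cvg_at_right_filter; exact: cF.
by rewrite below above addeCA addeA.
Qed.

(** The line is cut at 0 and the negative half is reflected by [x -> - x]. Folding reduces Gaussian
    integrals to the half-line and cancels odd terms. *)
Lemma ge0_integralT_fold {R : realType} (f : R -> R) :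
  (forall x, 0 <= f x) -> continuous f ->
  (\int[lebesgue_measure]_x (f x)%:E =
   \int[lebesgue_measure]_(x in `[0%R, +oo[) (f x + f (- x))%:E)%E.
Proof.
move=> f0 cf.
have mf : measurable_fun [set: R] f by exact: continuous_measurable_fun.
rewrite -(setUv `[0%R, +oo[%classic) ge0_integral_setU//= ; last 4 first.
- exact: measurableC.
- by apply/measurable_EFinP; rewrite setUv.
- by move=> x _; rewrite lee_fin.
- exact/disj_setPCl.
rewrite setCitvr integral_itv_bndo_bndc; last first.
  by apply/measurable_EFinP; exact: measurable_funTS.
rewrite -{2}oppr0 ge0_integration_by_substitutionNy//; last first.
  exact: continuous_subspaceT.
rewrite -ge0_integralD//=.
- by move=> x _; rewrite lee_fin.
- by apply/measurable_EFinP; exact: measurable_funTS.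
- by move=> x _; rewrite lee_fin.
- apply/measurable_EFinP; apply: measurable_funTS.
  exact: (measurableT_comp mf).
Qed.

(** Change of variables is available for the Radon-Nikodym derivative. It agrees almost everywhere
    with [normal_pdf], since both have the same integral, namely the normal probability, over every
    measurable set. *)
Lemma ge0_integral_normal_prob {R : realType} (m s : R) (f : R -> R) :
  (forall x, 0 <= f x) -> measurable_fun [set: R] f ->
  (\int[normal_prob m s]_x (f x)%:E =
   \int[lebesgue_measure]_x (f x * normal_pdf m s x)%:E)%E.
Proof.
move=> f0 mf; have dom := normal_prob_dominates m s.
rewrite -(Radon_Nikodym_SigmaFinite.change_of_variables dom)//; last first.
  exact/measurable_EFinP.
have mRN := measurable_int _ (Radon_Nikodym_SigmaFinite.f_integrable dom).
have mpdf : measurable_fun [set: R] (fun x => (normal_pdf m s x)%:E).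
  by apply/measurable_EFinP; exact: measurable_normal_pdf.
apply: ae_eq_integral => //.
- by apply: emeasurable_funM => //; exact/measurable_EFinP.
- apply/measurable_EFinP; apply: measurable_funM => //.
  exact: measurable_normal_pdf.
have : ae_eq lebesgue_measure setT
    (Radon_Nikodym_SigmaFinite.f (normal_prob m s) lebesgue_measure)
    (fun x => (normal_pdf m s x)%:E).
  apply: integral_ae_eq => //.
    exact: Radon_Nikodym_SigmaFinite.f_integrable.
  by move=> E _ mE; rewrite -Radon_Nikodym_SigmaFinite.f_integral.
apply: filterS => x + Dx => /(_ Dx) ->.
by rewrite EFinM.
Qed.

(** Variance plus squared bias: the average error of the constant estimate [c] under a centered
    Gaussian prior, least at the prior mean [c = 0]. *)
Lemma integral_normal_prob_sqr {R : realType} (s c : R) : 0 < s ->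
  (\int[normal_prob 0 s]_x ((c - x) ^+ 2)%:E = (s ^+ 2 + c ^+ 2)%:E)%E.
Proof.
move=> s_gt0; have s0 : s != 0 by rewrite gt_eqF.
have phi0 x : 0 <= normal_pdf 0 s x by exact: normal_pdf_ge0.
have mphi : measurable_fun setT (normal_pdf 0 s).
  exact: measurable_normal_pdf.
have phiN x : normal_pdf 0 s (- x) = normal_pdf 0 s x.
  by rewrite normal_pdfE// /normal_fun !subr0 sqrrN.
have sqrphi0 x : 0 <= x ^+ 2 * normal_pdf 0 s x by rewrite mulr_ge0 ?sqr_ge0.
have c20 : 0 <= 2 * c ^+ 2 by rewrite mulr_ge0 ?sqr_ge0.
have mcst (k : R) : measurable_fun setT (fun x : R => k * normal_pdf 0 s x).
  exact: measurable_funM.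
have msqr1 : measurable_fun setT (fun x : R => x ^+ 2 * normal_pdf 0 s x).
  by apply: measurable_funM => //; exact: measurable_funX.
have msqr (k : R) :
    measurable_fun setT (fun x : R => k * (x ^+ 2 * normal_pdf 0 s x)).
  exact: measurable_funM.
rewrite ge0_integral_normal_prob//; last 2 first.
- by move=> x; rewrite sqr_ge0.
- by apply: measurable_funX; exact: measurable_funB.
rewrite ge0_integralT_fold; last 2 first.
- by move=> x; rewrite mulr_ge0// sqr_ge0.
- exact: continuous_sqr_mul_normal_pdf.
(* The cross terms cancel: [(c - x) ^+ 2 + (c + x) ^+ 2 = 2 * x ^+ 2 + 2 * c ^+ 2]. *)
transitivity (\int[lebesgue_measure]_(x in `[0%R, +oo[)
    ((2 * (x ^+ 2 * normal_pdf 0 s x))%:E +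
     (2 * c ^+ 2 * normal_pdf 0 s x)%:E))%E.
  by apply: eq_integral => x _; rewrite phiN -EFinD; congr EFin; ring.
rewrite ge0_integralD//=; last 4 first.
- by move=> x _; rewrite lee_fin mulr_ge0//.
- by apply/measurable_EFinP; exact: measurable_funTS (msqr 2).
- by move=> x _; rewrite lee_fin mulr_ge0//.
- by apply/measurable_EFinP; exact: measurable_funTS (mcst _).
under eq_integral do rewrite EFinM.
rewrite ge0_integralZl//=; last 2 first.
- by apply/measurable_EFinP; exact: measurable_funTS msqr1.
- by move=> x _; rewrite lee_fin.
rewrite integral0y_sqr_normal_pdf// -ge0_integralZl//=; last 2 first.
- by apply/measurable_EFinP; exact: measurable_funTS (mcst _).
- by move=> x _; rewrite lee_fin mulr_ge0// ?sqr_ge0.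
rewrite -ge0_integralD//=; last 4 first.
- by move=> x _; rewrite mule_ge0// lee_fin mulr_ge0// sqr_ge0.
- apply: emeasurable_funM => //.
  by apply/measurable_EFinP; exact: measurable_funTS (mcst _).
- by move=> x _; rewrite lee_fin mulr_ge0//.
- by apply/measurable_EFinP; exact: measurable_funTS (mcst _).
(* Once [x ^+ 2] is traded for [s ^+ 2], only multiples of the density remain; unfolding back to the
   whole line uses its total mass 1. *)
transitivity (\int[lebesgue_measure]_x
    ((s ^+ 2 + c ^+ 2)%:E * (normal_pdf 0 s x)%:E))%E.
  rewrite (@ge0_integralT_fold _
    (fun x => (s ^+ 2 + c ^+ 2) * normal_pdf 0 s x)).
  - by apply: eq_integral => x _; rewrite phiN -EFinM -EFinD; congr EFin; ring.
  - by move=> x; rewrite mulr_ge0// addr_ge0// sqr_ge0.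
  - by move=> x; apply: cvgM; [exact: cvg_cst|exact: continuous_normal_pdf].
rewrite ge0_integralZl//=; last 3 first.
- exact/measurable_EFinP.
- by move=> x _; rewrite lee_fin.
- by rewrite lee_fin addr_ge0// sqr_ge0.
by rewrite integral_normal_pdf mule1.
Qed.

(** * Euclidean norm and the Gaussian law in dimension one *)

Lemma sqr_l2norm {R : realType} {n : nat} (x : 'cV[R]_n) :
  l2norm x ^+ 2 = \sum_i x i 0 ^+ 2.
Proof. by rewrite sqr_sqrtr// sumr_ge0// => i _; exact: sqr_ge0. Qed.

Lemma sqr_l2norm1 {R : realType} (x : 'cV[R]_1) : l2norm x ^+ 2 = x 0 0 ^+ 2.
Proof. by rewrite sqr_l2norm big_ord1. Qed.

Lemma l2norm0_eq {R : realType} {n : nat} (x : 'cV[R]_n) :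
  l2norm x = 0 -> x = 0.
Proof.
move=> x0; apply/matrixP => i j; rewrite mxE (ord1 j).
have /eqP := sqr_l2norm x.
rewrite x0 expr0n/= eq_sym psumr_eq0 => [/allP/(_ i)|k _]; last exact: sqr_ge0.
by rewrite mem_index_enum sqrf_eq0 => /(_ isT)/eqP.
Qed.

(** Here [iid_law] is the image of a product of the normal law with the Dirac mass at the empty
    tuple; Tonelli integrates the latter out. *)
Lemma integral_iso_gaussian1 {R : realType} (s : R) (f : 'cV[R]_1 -> \bar R) :
  measurable_fun setT f -> (forall x, 0 <= f x)%E ->
  (\int[iso_gaussian 1 s]_x f x = \int[normal_prob 0 s]_x f (const_mx x))%E.
Proof.
move=> mf f0; rewrite /iso_gaussian ge0_integral_distribution//=.
have mfc : measurable_fun setT (f \o @col_of_tuple R 1).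
  by apply: measurableT_comp => //; exact: measurable_col_of_tuple.
rewrite ge0_integral_distribution//=.
have mfcc := measurableT_comp mfc (@measurable_cons_pair _ _ 0).
rewrite fubini_tonelli1//=.
apply: eq_integral => x _; rewrite /fubini_F/= integral_dirac//=; last first.
  exact: (measurableT_comp mfcc (pair1_measurable x)).
rewrite diracT mul1e; congr f.
by apply/matrixP => i j; rewrite !mxE (ord1 i).
Qed.

(** * Lower bounds by atoms, and atoms of product laws *)

(** Every simple function below [f] is below [g], so the suprema compare. This applies to arbitrary
    integrands, such as [growth_integrand] or the inner integral of [average_risk]. *)
Lemma ge0_le_integralT {R : realType} {d} {T : measurableType d}
    (mu : {measure set T -> \bar R}) (f g : T -> \bar R) :
  (forall x, 0 <= f x)%E -> (forall x, f x <= g x)%E ->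
  (\int[mu]_x f x <= \int[mu]_x g x)%E.
Proof.
move=> f0 fg; have g0 x : (0 <= g x)%E by exact: le_trans (fg x).
rewrite !ge0_integralTE//; apply: le_ereal_sup => _ [h /= hf <-].
by exists h => // x; exact: le_trans (fg x).
Qed.

(** The device behind both lower bounds: the growth condition keeps the sample with A = 1, the risk
    bound keeps the data in which every sample has A = 0. *)
Lemma integral_ge_atom {R : realType} {d} {T : measurableType d}
    (mu : {measure set T -> \bar R}) (a : T) (f : T -> \bar R) :
  measurable [set a] -> (forall x, 0 <= f x)%E ->
  (f a * mu [set a] <= \int[mu]_x f x)%E.
Proof.
move=> ma f0; rewrite -integral_cst// integral_mkcond.
apply: ge0_le_integralT => x; rewrite patchE.
  by case: ifPn => //= /set_mem ->.
by case: ifPn => //= /set_mem ->.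
Qed.

Lemma measurable_nseq_tuple1 {d} {T : measurableType d} (a : T) (k : nat) :
  measurable [set a] -> measurable [set [tuple of nseq k a]].
Proof.
move=> ma.
rewrite (_ : [set _] = \bigcap_(i in [set: 'I_k])
    (@tnth k T ^~ i @^-1` [set a])).
  apply: fin_bigcap_measurable => // i _.
  by rewrite -[X in measurable X]setTI; exact: measurable_tnth.
apply/seteqP; split => [t /= -> i _ /=|t /= h].
  by rewrite tnth_nseq.
by apply: eq_from_tnth => i; rewrite tnth_nseq; exact: h.
Qed.

Lemma iid_law_nseq {d} {T : measurableType d} {R : realType}
    (P : probability T R) (a : T) (k : nat) : measurable [set a] ->
  iid_law P k [set [tuple of nseq k a]] = (P [set a] ^+ k)%E.
Proof.
move=> ma; elim: k => [|k IHk].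
  rewrite expe0 /= diracE mem_set//=; exact: val_inj.
have mk := measurable_nseq_tuple1 a k ma.
rewrite expeS -IHk /= /distribution /pushforward.
rewrite (_ : _ @^-1` _ = [set a] `*` [set [tuple of nseq k a]]).
  by rewrite product_measure1E.
apply/seteqP; split => [[x t]/= /(congr1 val)/= [-> h]|[x t]/= [-> ->]].
  by split => //; exact: val_inj.
exact: val_inj.
Qed.

Lemma measurable_mx_set1 {R : realType} {m n : nat} (A : 'M[R]_(m, n)) :
  measurable [set A].
Proof.
rewrite (_ : [set _] = \bigcap_(ij in [set: 'I_m * 'I_n])
    ((fun B : 'M[R]_(m, n) => B ij.1 ij.2) @^-1` [set A ij.1 ij.2])).
  apply: fin_bigcap_measurable => // -[i j] _ /=.
  by rewrite -[X in measurable X]setTI; exact: measurable_mx_entry.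
apply/seteqP; split => [B /= -> //|B /= h].
by apply/matrixP => i j; exact: (h (i, j)).
Qed.

(** * Loss and gradient in dimension one *)

Lemma squared_error11 {R : realType} (x : 'cV[R]_1) (s : 'M[R]_1 * 'cV[R]_1) :
  squared_error x s = 2^-1 * (s.1 0 0 * x 0 0 - s.2 0 0) ^+ 2.
Proof. by rewrite /squared_error sqr_l2norm1 !mxE big_ord1. Qed.

(** The coefficients cover both gradients in use: [k = 2^-1] with [a] and [b] read off a sample for
    the loss, [k = p / 2] with [a = 1] for the risk. *)
Lemma gradient_sqr_affine {R : realType} (k a b : R) (x : 'cV[R]_1) :
  gradient (fun y : 'cV[R]_1 => k * (a * y 0 0 - b) ^+ 2) x =
  const_mx (2 * k * a * (a * x 0 0 - b)).
Proof.
apply/matrixP => i j; rewrite !mxE (ord1 i).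
(* [g] is the function along the only coordinate line through [x]; its difference quotients at 0 are
   those of the directional derivative. *)
pose g (h : R) : R := k * (a * (h + x 0 0) - b) ^+ 2.
transitivity ('D_1 g 0).
  rewrite /derive; set u := (X in lim (X @ _)); set v := (X in _ = lim (X @ _)).
  suff -> : u = v by [].
  apply/funext => h; rewrite /u /v /g /=.
  by rewrite !mxE/= !addr0 /GRing.scale/= mulr1n mulr1 add0r.
have dg : is_derive (0 : R) (1 : R) g (2 * k * a * (a * x 0 0 - b)).
  rewrite /g; apply: is_derive_eq; rewrite /GRing.scale /=; ring.
by have [_ ->] := dg.
Qed.

(** * The Bernoulli design and its two-point sample law *)

Section bernoulli_design.
Context {R : realType}.
Implicit Types (p : R) (b : bool) (xs : 'cV[R]_1).

Definition bernoulli_design b : 'M[R]_1 := const_mx b%:R.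

Lemma measurable_bernoulli_design :
  measurable_fun [set: bool] bernoulli_design.
Proof. by []. Qed.

HB.instance Definition _ := isMeasurableFun.Build _ _ bool 'M[R]_1
  bernoulli_design measurable_bernoulli_design.

Definition bernoulli_design_law p : probability 'M[R]_1 R :=
  distribution (bernoulli_prob p) bernoulli_design.

Definition bernoulli_sample xs b : 'M[R]_1 * 'cV[R]_1 :=
  noiseless_sample xs (bernoulli_design b).

Lemma bernoulli_sample1 xs b : (bernoulli_sample xs b).1 0 0 = b%:R.
Proof. by rewrite mxE. Qed.

Lemma bernoulli_sample2 xs b : (bernoulli_sample xs b).2 0 0 = b%:R * xs 0 0.
Proof. by rewrite mxE big_ord1 mxE. Qed.

Lemma measurable_sample_set1 (s : 'M[R]_1 * 'cV[R]_1) : measurable [set s].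
Proof.
rewrite (_ : [set s] = [set s.1] `*` [set s.2]).
  by apply: measurableX; exact: measurable_mx_set1.
apply/seteqP; split => [_ -> //|[A b]/= [-> ->]].
by rewrite -surjective_pairing.
Qed.

(** The design entry of a sample reveals the bit, so the preimage of the sample is [[set b]], even
    when [xs = 0]. *)
Lemma regression_law_set1 p xs b : 0 <= p <= 1 ->
  regression_law (bernoulli_design_law p) xs [set bernoulli_sample xs b] =
  (if b then p else 1 - p)%:E.
Proof.
move=> p01; rewrite /regression_law /bernoulli_design_law /distribution.
rewrite /pushforward/= (_ : _ @^-1` _ = [set b]).
  rewrite bernoulli_probE// !diracE; case: b.
    by rewrite mem_set// memNset// mule1 mule0 adde0.
  by rewrite memNset// mem_set// mule1 mule0 add0e.
apply/seteqP; split => [c|c -> //] /= h.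
have := congr1 (fun s : 'M[R]_1 * 'cV[R]_1 => s.1 0 0) h.
rewrite /= !mxE => /eqP; rewrite eqr_nat.
by case: b {h}; case: c.
Qed.

(** [pos] pushes nonnegative functions through the two image laws; splitting into positive and
    negative parts extends this to signed integrands, as needed for the mean of the gradient. *)
Lemma integral_regression_law p xs (f : 'M[R]_1 * 'cV[R]_1 -> R) :
  0 <= p <= 1 -> measurable_fun setT f ->
  (\int[regression_law (bernoulli_design_law p) xs]_s (f s)%:E =
   (p * f (bernoulli_sample xs true) +
    (1 - p) * f (bernoulli_sample xs false))%:E)%E.
Proof.
move=> p01 mf.
have pos (g : 'M[R]_1 * 'cV[R]_1 -> \bar R) : measurable_fun setT g ->
    (forall s, 0 <= g s)%E ->
    (\int[regression_law (bernoulli_design_law p) xs]_s g s =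
     p%:E * g (bernoulli_sample xs true) +
     (1 - p)%:E * g (bernoulli_sample xs false))%E.
  move=> mg g0; rewrite /regression_law ge0_integral_distribution//.
  have mgs := measurableT_comp mg (measurable_noiseless_sample xs).
  rewrite /bernoulli_design_law ge0_integral_distribution//; last first.
    by move=> A; exact: g0.
  by rewrite integral_bernoulli_prob// => b; exact: g0.
have mEf : measurable_fun setT (EFin \o f) by exact/measurable_EFinP.
rewrite integralE !pos//=; last 2 first.
- exact: measurable_funeneg.
- exact: measurable_funepos.
rewrite !funeposE !funenegE/= -!EFin_max -!EFinM -!EFinD; congr EFin.
set a := f _; set b := f _.
have maxN (z : R) : Num.max z 0 - Num.max (- z) 0 = z.
  by case: (leP z 0) => z0; case: (leP (- z) 0) => z0'; lra.
rewrite -[in RHS](maxN a) -[in RHS](maxN b); ring.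
Qed.

End bernoulli_design.

(** * Interpolation, minimizers and sign of the growth integrand *)

Lemma l2norm0 {R : realType} {n : nat} : l2norm (0 : 'cV[R]_n) = 0.
Proof. by rewrite /l2norm big1 ?sqrtr0// => i _; rewrite mxE expr0n. Qed.

(** The exceptional set consists of the pairs with [A *m xs != b]; its preimage under
    [noiseless_sample xs] is empty. Off this set the infimum 0 is attained at [xs]. *)
Lemma interpolating_regression_law {R : realType} {m n : nat}
    (mu : probability 'M[R]_(m, n) R) (xs : 'cV[R]_n) :
  interpolating squared_error (regression_law mu xs) xs.
Proof.
pose g (s : 'M[R]_(m, n) * 'cV[R]_m) := s.1 *m xs - s.2.
have mg : measurable_fun setT g.
  apply: measurable_fun_mxP => i j.
  rewrite (_ : (fun _ => _) = (fun s : 'M[R]_(m, n) * 'cV[R]_m =>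
      \sum_k s.1 i k * xs k j - s.2 i j)); last first.
    by apply/funext => s; rewrite !mxE.
  apply: measurable_funB.
    apply: measurable_sum => k; apply: measurable_funM => //.
    exact: (measurableT_comp (measurable_mx_entry i k) measurable_fst).
  exact: (measurableT_comp (measurable_mx_entry i j) measurable_snd).
have mg0 : measurable (~` (g @^-1` [set 0])).
  apply: measurableC; rewrite -[X in measurable X]setTI; apply: mg => //.
  exact: measurable_mx_set1.
exists (~` (g @^-1` [set 0])); split => //.
  rewrite /= /regression_law /distribution /pushforward.
  rewrite (_ : _ @^-1` _ = set0) ?measure0//.
  by apply/seteqP; split => // A /=; apply; rewrite /g/= subrr.
apply: subsetC => -[A b] /= /eqP; rewrite subr_eq0 => /eqP Ab.
have F0 : squared_error xs (A, b) = 0.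
  by rewrite /squared_error/= Ab subrr l2norm0 expr0n mulr0.
split => //; apply/eqP; rewrite eq_le; apply/andP; split.
  apply: ge_inf; last by exists xs.
  by exists 0 => _ [x _ <-]; rewrite mulr_ge0// ?invr_ge0// sqr_ge0.
apply: lb_le_inf; first by exists 0; exists xs.
by move=> _ [x _ <-]; rewrite mulr_ge0// ?invr_ge0// sqr_ge0.
Qed.

Lemma minimizers_perfectly_conditioned {R : realType} {n : nat} {d}
    {S : measurableType d} (F : 'cV[R]_n -> S -> R) (P : probability S R)
    (xs : 'cV[R]_n) :
  perfectly_conditioned F P xs -> minimizers F P = [set xs].
Proof.
move=> [c c0 Fc]; apply/seteqP; split => [x /= /(_ xs)|_ /= -> y].
  rewrite !Fc subrr l2norm0 expr0n mulr0 lee_fin pmulr_rle0// => h.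
  apply/eqP; rewrite -subr_eq0; apply/eqP.
  apply: l2norm0_eq; apply/eqP; rewrite -sqrf_eq0; apply/eqP/le_anti.
  by rewrite h sqr_ge0.
rewrite !Fc lee_fin subrr l2norm0 expr0n mulr0.
by rewrite mulr_ge0 ?(ltW c0) ?sqr_ge0.
Qed.

(* The gap need not be nonnegative (a sample outside the support of the law),
   but when it is negative the minimum is nonpositive as well. *)
Lemma growth_integrand_ge0 {R : realType} {n : nat} {d} {S : measurableType d}
    (F : 'cV[R]_n -> S -> R) (xs : 'cV[R]_n) (alpha : R) (x : 'cV[R]_n)
    (s : S) :
  0 <= alpha -> (0 <= growth_integrand F xs alpha x s)%E.
Proof.
move=> alpha0; rewrite /growth_integrand; set gap := F x s - F xs s.
have inv0 : (0 <= (l2norm (gradient (F ^~ s) x) ^+ 2)%:E^-1)%E.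
  by rewrite inve_ge0 lee_fin sqr_ge0.
have [gap0|gap0] := leP 0 gap.
  apply: mule_ge0; first by rewrite lee_fin.
  by rewrite le_min lee_fin alpha0 mule_ge0// lee_fin.
apply: mule_le0; first by rewrite lee_fin ltW.
by rewrite ge_min; apply/orP; right; rewrite mule_le0_ge0// lee_fin ltW.
Qed.

(** * Growth, noise-to-signal ratio and risk for the Bernoulli design *)

Section bernoulli_regression.
Context {R : realType}.
Variables (p : R) (p_gt0 : 0 < p) (p_le1 : p <= 1).
Implicit Types (x xs : 'cV[R]_1).

Let p01 : 0 <= p <= 1. Proof. by rewrite p_le1 ltW. Qed.

Local Notation P := (regression_law (bernoulli_design_law p)).

Let m1 : measurable_fun setT (fun s : 'M[R]_1 * 'cV[R]_1 => s.1 0 0).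
Proof. exact: (measurableT_comp (measurable_mx_entry 0 0) measurable_fst). Qed.

Let m2 : measurable_fun setT (fun s : 'M[R]_1 * 'cV[R]_1 => s.2 0 0).
Proof. exact: (measurableT_comp (measurable_mx_entry 0 0) measurable_snd). Qed.

Lemma risk_bernoulli_design xs x :
  risk squared_error (P xs) x = (p / 2 * l2norm (x - xs) ^+ 2)%:E.
Proof.
rewrite /risk unlock.
under eq_integral do rewrite squared_error11.
rewrite integral_regression_law//; last first.
  apply: measurable_funM => //; apply: measurable_funX.
  by apply: measurable_funB => //; exact: measurable_funM.
rewrite !bernoulli_sample1 !bernoulli_sample2 sqr_l2norm1 !mxE; congr EFin.
by rewrite /=; field.
Qed.

Lemma perfectly_conditioned_bernoulli_design xs :
  perfectly_conditioned squared_error (P xs) xs.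
Proof. by exists (p / 2); [rewrite divr_gt0|exact: risk_bernoulli_design]. Qed.

Lemma gradient_squared_error11 x (s : 'M[R]_1 * 'cV[R]_1) :
  gradient (squared_error ^~ s) x =
  const_mx (s.1 0 0 * (s.1 0 0 * x 0 0 - s.2 0 0)).
Proof.
rewrite (_ : squared_error ^~ s =
  (fun y : 'cV[R]_1 => 2^-1 * (s.1 0 0 * y 0 0 - s.2 0 0) ^+ 2)).
  by rewrite gradient_sqr_affine; congr const_mx; field.
by apply/funext => y; rewrite squared_error11.
Qed.

(** With [u = x - xs], on A = 1 the gap is [u ^+ 2 / 2] and the squared gradient [u ^+ 2]. Weighting
    by [p] gives [p / 2 * min(alpha, 1/2) * u ^+ 2], whence the constants [p / 2] and [p / 4]. On A
    = 0 the gap vanishes, so keeping one atom loses nothing. *)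
Lemma growth_condition1_bernoulli_design xs :
  growth_condition1 squared_error (P xs) xs (p / 2) (p / 4).
Proof.
move=> alpha x alpha0.
have := integral_ge_atom (P xs) (bernoulli_sample xs true)
  (growth_integrand squared_error xs alpha x) (measurable_sample_set1 _)
  (fun s => growth_integrand_ge0 _ _ _ _ s alpha0).
apply: le_trans.
rewrite [X in (_ * X)%E](regression_law_set1 p xs true p01).
rewrite /growth_integrand gradient_squared_error11.
rewrite !squared_error11 !bernoulli_sample1 !bernoulli_sample2.
rewrite !sqr_l2norm1 !mxE !mul1r subrr expr0n/= mulr0 subr0.
set u := x 0 0 - xs 0 0.
(* At [u = 0] the quotient contains [0^-1 = +oo]; the zero gap in front makes both sides 0. *)
have [->|u0] := eqVneq u 0.
  by rewrite expr0n/= !mulr0 !mul0e.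
rewrite inver sqrf_eq0 (negbTE u0) -EFinM.
rewrite (_ : 2^-1 * u ^+ 2 * (u ^+ 2)^-1 = 2^-1); last first.
  by rewrite mulfK// sqrf_eq0.
rewrite -EFin_min -!EFinM lee_fin.
have u2 : 0 <= u ^+ 2 by rewrite sqr_ge0.
rewrite [leRHS](_ : _ = (p / 2 * Num.min alpha 2^-1) * u ^+ 2); last by ring.
rewrite ler_wpM2r//.
by rewrite ge_min; case: (leP alpha 2^-1) => _; apply/orP; [left|right; lra].
Qed.

(** The stochastic gradient is [u] with probability [p] and 0 otherwise: its mean is [p * u], the
    gradient of the risk, and its variance [p * (1 - p) * u ^+ 2]. The quotient is [(1 - p) / p]. *)
Lemma noise_to_signal_bernoulli_design xs :
  (noise_to_signal squared_error (P xs) xs <= (p^-1 - 1)%:E)%E.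
Proof.
apply: ge_ereal_sup => _ [x /= xxs <-].
set u := x 0 0 - xs 0 0.
have u0 : u != 0.
  apply: contra_neq xxs => u0; apply/matrixP => i j; rewrite (ord1 i) (ord1 j).
  by apply/eqP; rewrite -subr_eq0; apply/eqP.
have mgrad : measurable_fun setT (fun s : 'M[R]_1 * 'cV[R]_1 =>
    s.1 0 0 * (s.1 0 0 * x 0 0 - s.2 0 0)).
  apply: measurable_funM => //; apply: measurable_funB => //.
  exact: measurable_funM.
have -> : gradient (fine \o risk squared_error (P xs)) x = const_mx (p * u).
  rewrite (_ : _ \o _ =
      (fun y : 'cV[R]_1 => p / 2 * (1 * y 0 0 - xs 0 0) ^+ 2)).
    by rewrite gradient_sqr_affine; congr const_mx; rewrite /u; field.
  apply/funext => y; rewrite /= risk_bernoulli_design/= sqr_l2norm1 !mxE.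
  by rewrite mul1r.
rewrite /vec_variance.
have -> : vec_mean (P xs) (fun s => gradient (squared_error ^~ s) x) =
    const_mx (p * u).
  apply/matrixP => i j; rewrite !mxE (ord1 i) unlock.
  under eq_integral do rewrite gradient_squared_error11 mxE.
  rewrite integral_regression_law// !bernoulli_sample1 !bernoulli_sample2 /=.
  by rewrite /u; ring.
under eq_integral do rewrite gradient_squared_error11 sqr_l2norm1 !mxE.
rewrite integral_regression_law//; last first.
  by apply: measurable_funX; exact: measurable_funB.
rewrite !bernoulli_sample1 !bernoulli_sample2 sqr_l2norm1 mxE /=.
have p0 : p != 0 by rewrite gt_eqF.
rewrite inver sqrf_eq0 mulf_eq0 (negbTE p0) (negbTE u0)/= -EFinM lee_fin.
rewrite (_ : _ * _ = p^-1 - 1)// /u; field.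
by rewrite p0 -/u u0.
Qed.

Lemma min_average_risk_bernoulli_design (r : R) (k : nat) : 0 < r ->
  ((r ^+ 2 * (1 - p) ^+ k)%:E <=
   min_average_risk squared_error P (regression_prior 1 r) k)%E.
Proof.
move=> r0; apply: le_ereal_inf_tmp => _ [xhat /= _ <-].
(* The answer to uninformative data. The parameter 0 in the sample is arbitrary: [s0] below shows
   that the sample with A = 0 is the same for every [t], so [c] does not depend on [t]. *)
pose c := xhat [tuple of nseq k (bernoulli_sample 0 false)].
have msqr : measurable_fun setT
    (fun t : 'cV[R]_1 => ((1 - p) ^+ k * (c 0 0 - t 0 0) ^+ 2)%:E).
  apply/measurable_EFinP; apply: measurable_funM => //.
  apply: measurable_funX; apply: measurable_funB => //.
  exact: measurable_mx_entry.
have q0 : 0 <= (1 - p) ^+ k by rewrite exprn_ge0// subr_ge0.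
have wsqr_ge0 t : (0 <= ((1 - p) ^+ k * (c 0 0 - t 0 0) ^+ 2)%:E :> \bar R)%E.
  by rewrite lee_fin mulr_ge0// sqr_ge0.
(* The middle term is the average error of the constant [c], weighted by the probability of
   uninformative data. It equals [(1 - p) ^+ k * (r ^+ 2 + c 0 0 ^+ 2)], as the prior has standard
   deviation [r] when n = 1. *)
apply: (@le_trans _ _ (\int[regression_prior 1 r]_t
    ((1 - p) ^+ k * (c 0 0 - t 0 0) ^+ 2)%:E)%E).
  rewrite integral_iso_gaussian1// divr1 sqrtr_sqr gtr0_norm//.
  under eq_integral do rewrite mxE EFinM.
  rewrite ge0_integralZl//=; last 2 first.
  - by apply/measurable_EFinP; apply: measurable_funX; exact: measurable_funB.
  - by move=> x _; rewrite lee_fin sqr_ge0.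
  rewrite integral_normal_prob_sqr// -EFinM lee_fin mulrC ler_wpM2l//.
  by rewrite lerDl sqr_ge0.
(* For fixed [t], only the atom where all [k] samples have A = 0 is kept; its mass is
   [(1 - p) ^+ k]. *)
apply: ge0_le_integralT => // t.
have dist2 s : (dist_set (xhat s) (minimizers squared_error (P t)) ^+ 2)%E =
    ((xhat s 0 0 - t 0 0) ^+ 2)%:E.
  rewrite (minimizers_perfectly_conditioned _ _ _
    (perfectly_conditioned_bernoulli_design t)).
  by rewrite /dist_set image_set1 ereal_inf1 -EFin_expe sqr_l2norm1 !mxE.
have s0 : bernoulli_sample t false = bernoulli_sample 0 false.
  rewrite /bernoulli_sample /noiseless_sample (_ : bernoulli_design false = 0).
    by rewrite !mul0mx.
  by apply/matrixP => i j; rewrite !mxE.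
have := integral_ge_atom (iid_law (P t) k)
  [tuple of nseq k (bernoulli_sample t false)]
  (fun s => (dist_set (xhat s) (minimizers squared_error (P t)) ^+ 2)%E)
  (measurable_nseq_tuple1 _ k (measurable_sample_set1 _)).
rewrite [X in (_ * X)%E](iid_law_nseq _ _ k (measurable_sample_set1 _)).
rewrite [X in (X ^+ k)%E](regression_law_set1 p t false p01).
rewrite dist2 -EFin_expe -EFinM s0 mulrC; apply.
by move=> s; rewrite dist2 lee_fin sqr_ge0.
Qed.

End bernoulli_regression.

(** * Normalization of the prior and choice of the parameters *)

Lemma integral_regression_prior1 {R : realType} (r : R) : 0 < r ->
  (\int[regression_prior 1 r]_x (l2norm x ^+ 2)%:E = (r ^+ 2)%:E)%E.
Proof.
move=> r0; under eq_integral do rewrite sqr_l2norm1.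
rewrite integral_iso_gaussian1; last 2 first.
- apply/measurable_EFinP; apply: measurable_funX; exact: measurable_mx_entry.
- by move=> x; rewrite lee_fin sqr_ge0.
rewrite divr1 sqrtr_sqr gtr0_norm//.
(* The second moment is the error of the constant estimate 0. *)
under eq_integral do rewrite mxE -sqrrN -sub0r.
by rewrite integral_normal_prob_sqr// expr0n addr0.
Qed.

Theorem theorem5 (R : realType) (r : R) (hr : 0 < r) :
  (forall lambda1 : R, 0 < lambda1 -> lambda1 <= 4^-1 ->
    exists (m n : nat) (mu : probability 'M[R]_(m, n) R),
      [/\ (0 < m)%N, (0 < n)%N,
          (\int[regression_prior n r]_x (l2norm x ^+ 2)%:E = (r ^+ 2)%:E)%E,
          (exists2 lambda0 : R, 0 < lambda0 &
             forall xs : 'cV[R]_n,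
             [/\ interpolating squared_error (regression_law mu xs) xs,
                 perfectly_conditioned squared_error (regression_law mu xs) xs &
                 growth_condition1 squared_error (regression_law mu xs) xs
                   lambda0 lambda1]) &
          forall k : nat, (1 <= k)%N ->
            ((r ^+ 2 * (1 - 4 * lambda1) ^+ k)%:E <=
             min_average_risk squared_error (regression_law mu)
               (regression_prior n r) k)%E])
  /\
  (forall rho : R, 1 <= rho ->
    exists (m n : nat) (mu : probability 'M[R]_(m, n) R),
      [/\ (0 < m)%N, (0 < n)%N,
          (forall xs : 'cV[R]_n,
             [/\ interpolating squared_error (regression_law mu xs) xs,
                 perfectly_conditioned squared_error (regression_law mu xs) xs &
                 (noise_to_signal squared_error (regression_law mu xs) xs
                    <= rho%:E)%E]) &
          forall k : nat, (1 <= k)%N ->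
            ((r ^+ 2 * (1 - rho^-1) ^+ k)%:E <=
             min_average_risk squared_error (regression_law mu)
               (regression_prior n r) k)%E]).

Proof.
split=> [lambda1 l0 l4|rho rho1].
  have p0 : 0 < 4 * lambda1 by rewrite mulr_gt0.
  (* The bound [lambda1 <= 4^-1] is what makes [4 * lambda1] a probability. *)
  have p1 : 4 * lambda1 <= 1 by lra.
  exists 1%N, 1%N, (bernoulli_design_law (4 * lambda1)); split => //.
  - exact: integral_regression_prior1.
  - exists (4 * lambda1 / 2); first by rewrite divr_gt0.
    move=> xs; split.
    + exact: interpolating_regression_law.
    + exact: perfectly_conditioned_bernoulli_design.
    + have := growth_condition1_bernoulli_design _ p0 p1 xs.
      by rewrite [4 * lambda1 / 4]mulrAC divff// mul1r.
  - by move=> k _; exact: min_average_risk_bernoulli_design.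
have rho0 : 0 < rho by rewrite (lt_le_trans ltr01).
have p0 : 0 < rho^-1 by rewrite invr_gt0.
have p1 : rho^-1 <= 1 by rewrite invf_le1.
exists 1%N, 1%N, (bernoulli_design_law rho^-1); split => //.
- move=> xs; split.
  + exact: interpolating_regression_law.
  + exact: perfectly_conditioned_bernoulli_design.
  (* With [p = rho^-1] the ratio is at most [rho - 1], which is below [rho]. *)
  + apply: le_trans (noise_to_signal_bernoulli_design _ p0 p1 xs) _.
    by rewrite invrK lee_fin lerBlDr lerDl.
- by move=> k _; exact: min_average_risk_bernoulli_design.
Qed.
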